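(* Let $G$ be a group of order $n$, written additively, and let $P\subseteq G$ be an $(n,mk,\sigma,\mu)$-partial difference set which is partitioned by a collection $\mathcal{S}'=\{D_1,\ldots,D_m\}$ of pairwise disjoint $k$-subsets of $G$. (i) $\mathcal{S}'$ is an $(n,m,k,\lambda)$-external difference family if and only if $\mathcal{S}'$ is a proper $(n,m,k,\sigma-\lambda,\mu-\lambda)$-disjoint partial difference family. (ii) $\mathcal{S}'$ is an $(n,m,k,\lambda)$-disjoint difference family if and only if $\mathcal{S}'$ is a proper $(n,m,k,\sigma-\lambda,\mu-\lambda)$-external partial difference family.
   Context: $G^*=G\setminus\{0\}$. For $D\subseteq G$, $\Delta(D)$ is the multiset $\{x-y: x,y\in D,\ x\neq y\}$; for disjoint $D_1,D_2\subseteq G$, $\Delta(D_1,D_2)$ is the multiset $\{x-y:x\in D_1,y\in D_2\}$. For $A\subseteq G$ and an integer $\lambda\ge 0$, $\lambda A$ denotes the multiset consisting of $\lambda$ copies of each element of $A$; sums/unions of multisets are multiset unions. A $k$-subset $P$ of $G$ is an $(n,k,\lambda,\mu)$-partial difference set (PDS) if $\Delta(P)=\lambda P+\mu(G^*\setminus P)$. A collection of $m$ disjoint $k$-subsets $\{D_1,\dots,D_m\}$ is an $(n,m,k,\lambda)$-disjoint difference family (DDF) if $\bigcup_i\Delta(D_i)=\lambda G^*$, and an $(n,m,k,\lambda)$-external difference family (EDF) if $\bigcup_{i\neq j}\Delta(D_i,D_j)=\lambda G^*$. For a collection $\{D_1,\dots,D_m\}$ of disjoint $k$-subsets of $G^*$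 with $S=\bigcup_i D_i$: it is an $(n,m,k,\lambda,\mu)$-disjoint partial difference family (DPDF) if $\bigcup_{i}\Delta(D_i)=\lambda S+\mu(G^*\setminus S)$, and an $(n,m,k,\lambda,\mu)$-external partial difference family (EPDF) if $\bigcup_{i\neq j}\Delta(D_i,D_j)=\lambda S+\mu(G^*\setminus S)$; it is called proper if $\lambda\neq\mu$.
   Formalization: Assumes in addition σ ≠ μ (otherwise ''proper'' fails, e.g. a (7,3,1) difference set with m=1, λ=0) and P ≠ {0} (fails for the trivial group); σ−λ and μ−λ are read as integers, negative only if the set they multiply is empty. *)

(* Defs.v *)
From HB Require Import structures.
From mathcomp Require Import all_boot all_order all_algebra all_fingroup.

Set Implicit Arguments.
Unset Strict Implicit.
Unset Printing Implicit Defensive.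

Import GRing.Theory.
Local Open Scope ring_scope.

(* The group, not assumed abelian, is a whole finGroupType: the additive      *)
(* x - y and 0 of the mathematical text are x * y^-1 and 1 here.              *)
(* A multiset on the group is its multiplicity function, with values in int,  *)
(* so that multiset union is pointwise addition.                              *)

Section DifferenceFamilies.

Variable gT : finGroupType.

Definition mult := {ffun gT -> int}.

Definition nonid : {set gT} := [set~ 1%g].

(* lam may be negative, since parameters such as sigma - lambda occur. In an  *)
(* equation with a genuine multiset this forces lam >= 0 unless A is empty.   *)
Definition copies (lam : int) (A : {set gT}) : mult :=
  [ffun g => if g \in A then lam else 0].

Definition intdiff (D : {set gT}) : mult :=
  [ffun g => #|[set p : gT * gT | [&& p.1 \in D, p.2 \in D, p.1 != p.2
                                    & (p.1 * p.2^-1)%g == g]]|%:Z].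

Definition extdiff (D1 D2 : {set gT}) : mult :=
  [ffun g => #|[set p : gT * gT | [&& p.1 \in D1, p.2 \in D2
                                    & (p.1 * p.2^-1)%g == g]]|%:Z].

Definition is_PDS (n k lam mu : nat) (P : {set gT}) : Prop :=
  [/\ #|gT| = n, #|P| = k
    & intdiff P = copies lam%:Z P + copies mu%:Z (nonid :\: P)].

Definition disjoint_ksubsets (m k : nat) (D : 'I_m -> {set gT}) : Prop :=
  (forall i, #|D i| = k) /\ (forall i j, i != j -> [disjoint D i & D j]).

Definition support_union (m : nat) (D : 'I_m -> {set gT}) : {set gT} :=
  \bigcup_(i < m) D i.

Definition all_intdiff (m : nat) (D : 'I_m -> {set gT}) : mult :=
  \sum_(i < m) intdiff (D i).

Definition all_extdiff (m : nat) (D : 'I_m -> {set gT}) : mult :=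
  \sum_(i < m) \sum_(j < m | i != j) extdiff (D i) (D j).

Definition is_DDF (n m k lam : nat) (D : 'I_m -> {set gT}) : Prop :=
  [/\ #|gT| = n, disjoint_ksubsets k D
    & all_intdiff D = copies lam%:Z nonid].

Definition is_EDF (n m k lam : nat) (D : 'I_m -> {set gT}) : Prop :=
  [/\ #|gT| = n, disjoint_ksubsets k D
    & all_extdiff D = copies lam%:Z nonid].

Definition is_DPDF (n m k : nat) (lam mu : int) (D : 'I_m -> {set gT}) : Prop :=
  let S := support_union D in
  [/\ #|gT| = n, disjoint_ksubsets k D, (forall i, D i \subset nonid)
    & all_intdiff D = copies lam S + copies mu (nonid :\: S)].

Definition is_EPDF (n m k : nat) (lam mu : int) (D : 'I_m -> {set gT}) : Prop :=
  let S := support_union D in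
  [/\ #|gT| = n, disjoint_ksubsets k D, (forall i, D i \subset nonid)
    & all_extdiff D = copies lam S + copies mu (nonid :\: S)].

Definition is_proper_DPDF (n m k : nat) (lam mu : int)
    (D : 'I_m -> {set gT}) : Prop :=
  is_DPDF n k lam mu D /\ lam <> mu.

Definition is_proper_EPDF (n m k : nat) (lam mu : int)
    (D : 'I_m -> {set gT}) : Prop :=
  is_EPDF n k lam mu D /\ lam <> mu.

End DifferenceFamilies.

(* Main.v *)
Require Import Defs.
From HB Require Import structures.
From mathcomp Require Import all_boot all_order all_algebra all_fingroup.

Set Implicit Arguments.
Unset Strict Implicit.
Unset Printing Implicit Defensive.

Import GRing.Theory.
Local Open Scope ring_scope.

(** Splitting each pair of distinct elements of the union S of the D_i
    according to the blocks containing its two entries gives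
    [Delta(S) = U_i Delta(D_i) + U_(i != j) Delta(D_i, D_j)].
    Hence subtracting [lambda G^*] from the PDS equation exchanges the internal
    and external conditions. A partial difference set other than {0} does not
    contain 0: the multiplicity of 0 in Delta(P) is 0, so 0 in P forces
    sigma = 0, while any other x in P is the difference x - 0. *)

(** Disjointness leaves at most one nonzero summand. Membership becomes a number additive in the
    blocks, so counts of pairs expand bilinearly. *)
Lemma mem_bigcup_disjoint (T : finType) (m : nat) (D : 'I_m -> {set T}) (x : T) :
  (forall i j, i != j -> [disjoint D i & D j]) ->
  (x \in \bigcup_(i < m) D i) = (\sum_(i < m) (x \in D i))%N :> nat.
Proof.
move=> dis; case: bigcupP => [[i _ xi]|nx].
  rewrite (bigD1 i) //= xi big1 // => j ji.
  by rewrite (disjointFl (dis j i ji) xi).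
by rewrite big1 // => i _; apply/eqP; rewrite eqb0; apply/negP => xi; case: nx; exists i.
Qed.

Section DifferenceCounts.

Variable gT : finGroupType.
Implicit Types (A B P : {set gT}) (g : gT).

Lemma intdiff_sum A g :
  intdiff A g = (\sum_(p : gT * gT | (p.1 != p.2) && ((p.1 * p.2^-1)%g == g))
                   (p.1 \in A) * (p.2 \in A))%N%:Z.
Proof.
rewrite ffunE -sum1dep_card big_mkcond [in RHS]big_mkcond /=; congr (Posz _).
apply: eq_bigr => p _.
by case: (p.1 \in A); case: (p.2 \in A); case: ifP.
Qed.

(** Entries taken from disjoint sets are distinct, so [p.1 != p.2] holds for free; internal and
    external counts then run over the same pairs. *)
Lemma extdiff_sum A B g : [disjoint A & B] ->
  extdiff A B g = (\sum_(p : gT * gT | (p.1 != p.2) && ((p.1 * p.2^-1)%g == g))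
                     (p.1 \in A) * (p.2 \in B))%N%:Z.
Proof.
move=> dis; rewrite ffunE -sum1dep_card big_mkcond [in RHS]big_mkcond /=.
congr (Posz _); apply: eq_bigr => -[x y] _ /=.
have [xA|xA] := boolP (x \in A); last by case: ifP.
have [yB|yB] := boolP (y \in B); last by case: ifP.
suff -> : x != y by [].
by apply: contraTneq yB => <-; rewrite (disjointFr dis xA).
Qed.

Lemma intdiff_bigcup (m : nat) (D : 'I_m -> {set gT}) :
  (forall i j, i != j -> [disjoint D i & D j]) ->
  intdiff (support_union D) = all_intdiff D + all_extdiff D.
Proof.
move=> dis; apply/ffunP => g.
rewrite [RHS]ffunE /all_intdiff /all_extdiff !sum_ffunE -big_split /= intdiff_sum.
transitivity ((\sum_(i < m) \sum_(j < m)
    \sum_(p : gT * gT | (p.1 != p.2) && ((p.1 * p.2^-1)%g == g))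
      (p.1 \in D i) * (p.2 \in D j))%N%:Z).
  congr (Posz _); under [in RHS]eq_bigr do rewrite exchange_big.
  rewrite exchange_big /=; apply: eq_bigr => p _.
  rewrite !mem_bigcup_disjoint // big_distrl /=.
  by apply: eq_bigr => i _; rewrite big_distrr.
rewrite (big_morph Posz PoszD (erefl _)); apply: eq_bigr => i _.
(* The term [j = i] is the internal count of block [i]; the terms [j != i] are external. *)
rewrite (bigD1 i) //= PoszD -intdiff_sum; congr (_ + _).
rewrite sum_ffunE (big_morph Posz PoszD (erefl _)).
apply: eq_big => [j|j ji]; first by rewrite eq_sym.
by rewrite extdiff_sum // dis // eq_sym.
Qed.

Lemma PDS_sub_nonid (n k sigma mu : nat) P :
  is_PDS n k sigma mu P -> P <> [set 1%g] -> P \subset nonid gT.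
Proof.
case=> _ _ /ffunP PDS P1; apply/subsetP => x xP; rewrite !inE.
apply/eqP => x1; subst x; case: P1; apply/setP => y; rewrite inE.
have copiesP z : z \in P -> intdiff P z = sigma%:Z.
  by move=> zP; rewrite PDS !ffunE zP !inE zP addr0.
have sigma0 : sigma%:Z = 0.
  rewrite -(copiesP _ xP) ffunE; congr Posz; apply: eq_card0 => p; rewrite inE.
  apply/and4P => -[_ _ /eqP ne /eqP e]; apply: ne.
  by rewrite -[p.1](mulgKV p.2) e mul1g.
apply/idP/eqP => [yP|-> //]; apply/eqP; apply: contraT => y1.
(* As [sigma] is 0, no pair has quotient [y], yet [(y, 1)] is such a pair. *)
move: (copiesP _ yP); rewrite sigma0 ffunE => -[/eqP].
rewrite cards_eq0 => /eqP/setP/(_ (y, 1%g)).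
by rewrite !inE /= yP xP y1 invg1 mulg1 eqxx.
Qed.

(** When [P] avoids the identity, [nonid gT] is the disjoint union of [P] and [nonid gT :\: P], so
    [c] comes off both coefficients. *)
Lemma copies_nonid_sub P (s t c : int) : P \subset nonid gT ->
  copies s P + copies t (nonid gT :\: P) - copies c (nonid gT) =
  copies (s - c) P + copies (t - c) (nonid gT :\: P).
Proof.
move=> /subsetP sP; apply/ffunP => g; rewrite !ffunE in_setD.
have [gP|gP] := boolP (g \in P); first by rewrite sP // !addr0.
by case: (g \in nonid gT); rewrite ?add0r ?subr0.
Qed.

End DifferenceCounts.

Lemma addr_eq_subr (V : zmodType) (x y a b : V) :
  x + y = a -> (x = b <-> y = a - b).
Proof.
by move/(canRL (addrK _)) => ->; split=> [<-|->]; rewrite subKr.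
Qed.

(** Given [hsm], the case excluded by [hP0] occurs only in the trivial group: there [nonid gT] is
    empty, so the EDF and DDF equations hold vacuously, but the block containing 1 is not inside
    [nonid gT]. *)
Theorem theorem2p4 (gT : finGroupType) (n m k sigma mu : nat)
    (P : {set gT}) (D : 'I_m -> {set gT})
    (hG : #|gT| = n)
    (hP : is_PDS n (m * k)%N sigma mu P)
    (hsm : sigma <> mu)
    (hP0 : P <> [set 1%g])
    (hD : disjoint_ksubsets k D)
    (hDP : support_union D = P) :
  (forall lam : nat,
     is_EDF n k lam D <->
     is_proper_DPDF n k (sigma%:Z - lam%:Z) (mu%:Z - lam%:Z) D) /\
  (forall lam : nat,
     is_DDF n k lam D <->
     is_proper_EPDF n k (sigma%:Z - lam%:Z) (mu%:Z - lam%:Z) D).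
Proof.
have sP := PDS_sub_nonid hP hP0.
have sD i : D i \subset nonid gT.
  by apply: subset_trans sP; rewrite -hDP; apply: bigcup_sup.
have [_ _ PDS] := hP.
have split_diff : all_intdiff D + all_extdiff D =
    copies sigma%:Z P + copies mu%:Z (nonid gT :\: P).
  by rewrite -intdiff_bigcup ?hDP //; case: hD.
(* Properness comes from [hsm]: both parameters are shifted by the same [lam]. *)
have proper lam : sigma%:Z - lam%:Z <> mu%:Z - lam%:Z by move/addIr => -[].
split=> lam; rewrite /is_proper_DPDF /is_proper_EPDF /is_DPDF /is_EPDF hDP.
- rewrite -(copies_nonid_sub _ _ _ sP).
  have E := @addr_eq_subr _ (all_extdiff D) (all_intdiff D) _
    (copies lam%:Z (nonid gT)) (etrans (addrC _ _) split_diff).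
  by split=> [[_ _ /E e]|[[_ _ _ /E e] _]].
- rewrite -(copies_nonid_sub _ _ _ sP).
  have E := addr_eq_subr (copies lam%:Z (nonid gT)) split_diff.
  by split=> [[_ _ /E e]|[[_ _ _ /E e] _]].
Qed.
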